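(* Let $3 \leq s \leq t$ be integers. There is a constant $c=c(s,t)$ such that for all trees $T_1$ and $T_2$ on $s$ and $t$ vertices respectively and all integers $n\ge s+t$, $$\mathrm{ex}(n,K_{s,t}^-)/2 \leq \mathrm{ar}^{\star}(n,T_1 + T_2) \leq c\, n^{2-1/s}.$$
   Context: The join $G_1+G_2$ of two graphs is obtained by taking vertex-disjoint copies of $G_1$ and $G_2$ and adding all edges between them. $K_{s,t}^-$ is the graph obtained from the complete bipartite graph $K_{s,t}$ by removing one edge. $\mathrm{ex}(n,H)$ is the maximum number of edges in an $n$-vertex graph with no copy of $H$ as a (not necessarily induced) subgraph. A star-colouring of a graph $G$ is an edge-colouring of $G$ in which every colour class is a star (a copy of $K_{1,m}$ with $m\ge 1$, a single edge being allowed). An edge-coloured graph is rainbow if all its edges have different colours. For a graph $H$, $\mathrm{ar}^{\star}(n,H)$ denotes the maximum number of colours in a star-colouring of $K_n$ without a rainbow copy of $H$. *)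

(* Defs.v *)
From HB Require Import structures.
From mathcomp Require Import all_boot.

Set Implicit Arguments.
Unset Strict Implicit.
Unset Printing Implicit Defensive.

Section Graphs.
Variable V : finType.

Record sgraph := SGraph {
  edges : {set {set V}};
  edgesP : [forall e in edges, #|e| == 2]
}.

HB.instance Definition _ := [isSub for edges].
HB.instance Definition _ := [Finite of sgraph by <:].

Definition adj (G : sgraph) : rel V := fun x y => [set x; y] \in edges G.

(* The relation is symmetrised, and its diagonal ignored. *)
Definition edges_of_rel (r : rel V) : {set {set V}} :=
  [set [set p.1; p.2] | p in [pred p : V * V | (p.1 != p.2) && r p.1 p.2]].

Lemma edges_of_rel_card2 (r : rel V) :
  [forall e in edges_of_rel r, #|e| == 2].
Proof.
apply/forall_inP => e /imsetP[p + Ee]; rewrite Ee inE cards2.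
by case/andP=> ->.
Qed.

Definition sgraph_of_rel (r : rel V) : sgraph :=
  SGraph (edges_of_rel_card2 r).

Definition complete : sgraph := sgraph_of_rel (fun _ _ => true).

Definition connected (G : sgraph) : Prop :=
  0 < #|V| /\ forall x y : V, connect (adj G) x y.

(* [ucycle] alone also accepts the closed walks x, y, x along one edge. *)
Definition acyclic (G : sgraph) : Prop :=
  forall p : seq V, 2 < size p -> ~ ucycle (adj G) p.

Definition is_tree (G : sgraph) : Prop := connected G /\ acyclic G.

(* The edge set of a K_{1,m} with m >= 1: [v] is the centre, [L] the leaves. *)
Definition is_star (E : {set {set V}}) : bool :=
  [exists v : V, exists L : {set V},
    [&& v \notin L, L != set0 & E == [set [set v; x] | x in L]]].

(* A colouring is a function on all vertex sets; only its values on the edges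
   of the graph under consideration matter. *)
Definition colour_class (C : finType) (G : sgraph) (c : {ffun {set V} -> C})
    (a : C) : {set {set V}} :=
  [set e in edges G | c e == a].

Definition colours (C : finType) (G : sgraph) (c : {ffun {set V} -> C}) :
    {set C} :=
  c @: edges G.

Definition star_colouring (C : finType) (G : sgraph)
    (c : {ffun {set V} -> C}) : bool :=
  [forall a in colours G c, is_star (colour_class G c a)].

Definition rainbow (C : finType) (c : {ffun {set V} -> C})
    (E : {set {set V}}) : bool :=
  dinjectiveb c (mem E).

End Graphs.

Definition join_rel (V1 V2 : finType) (G1 : sgraph V1) (G2 : sgraph V2) :
    rel (V1 + V2) :=
  fun u v => match u, v with
  | inl x, inl y => adj G1 x y
  | inr x, inr y => adj G2 x y
  | _, _ => true
  end.

Definition join (V1 V2 : finType) (G1 : sgraph V1) (G2 : sgraph V2) :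
    sgraph (V1 + V2)%type :=
  sgraph_of_rel (join_rel G1 G2).

(* K_{s,t} without the edge between the vertices numbered 0 of both sides. *)
Definition Kst_minus_rel (s t : nat) : rel ('I_s + 'I_t) :=
  fun u v => match u, v with
  | inl i, inr j => ~~ ((i == 0 :> nat) && (j == 0 :> nat))
  | _, _ => false
  end.

Definition Kst_minus (s t : nat) : sgraph ('I_s + 'I_t)%type :=
  sgraph_of_rel (@Kst_minus_rel s t).

Section Extremal.
Variables (W V : finType) (H : sgraph W) (G : sgraph V).

Definition copy_edges (f : {ffun W -> V}) : {set {set V}} :=
  [set f @: e | e : {set W} in edges H].

Definition is_copy (f : {ffun W -> V}) : bool :=
  injectiveb f && (copy_edges f \subset edges G).

Definition has_copy : bool := [exists f : {ffun W -> V}, is_copy f].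

Definition has_rainbow_copy (C : finType) (c : {ffun {set V} -> C}) : bool :=
  [exists f : {ffun W -> V}, is_copy f && rainbow c (copy_edges f)].

End Extremal.

Definition ex (n : nat) (W : finType) (H : sgraph W) : nat :=
  \max_(G : sgraph 'I_n | ~~ has_copy H G) #|edges G|.

(* A palette with as many colours as K_n has edges loses no generality: a
   colouring uses at most one colour per edge, and need not use them all. *)
Definition ar_star (n : nat) (W : finType) (H : sgraph W) : nat :=
  let K := complete 'I_n in
  \max_(c : {ffun {set 'I_n} -> 'I_#|edges K|}
        | star_colouring K c && ~~ has_rainbow_copy H K c)
     #|colours K c|.

(* Main.v *)
Require Import Defs.
From mathcomp Require Import all_boot all_order all_algebra.
From mathcomp Require Import reals exp zify.

(* Lower bound: take a maximum K_{s,t}^- -free graph and keep the at least half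
   of its edges crossing a suitable vertex set A.  Give the kept edges pairwise
   different colours and every other edge the colour of its smaller endpoint.
   In a rainbow copy of T1 + T2 the other edges form an oriented graph F of
   out-degree at most 1 (towards larger vertices), so F has no triangle and no
   4-cycle.  Edges inside A or inside its complement are in F, which forces the
   copy to be split by A either into T1 and T2 or, when both are stars, into the
   two parts obtained by exchanging the centres.  Both parts are connected
   in F, so at most one edge between them is in F, and the kept edges between
   them contain K_{s,t}^-.

   Upper bound: orient one edge of each colour from the centre of its class to a
   leaf.  If there are many colours, dependent random choice gives a large set U
   in which every s-set has many common out-neighbours.  A canonical Ramsey
   argument finds a rainbow T1 in U, with vertex set S, and then a rainbow T2
   among the common out-neighbours of S that are not the chosen leaf of a colour
   of T1.  Disjoint edges have different colours, and an edge of T2 cannot share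
   its colour with an arc from S since it misses the centre of that colour. *)

Set Implicit Arguments.
Unset Strict Implicit.
Unset Printing Implicit Defensive.

(** * Edges and adjacency *)

Lemma edges_card2 (V : finType) (G : sgraph V) e : e \in edges G -> #|e| = 2.
Proof. by move=> eG; have /forall_inP/(_ _ eG)/eqP := edgesP G. Qed.

Lemma edges_of_relP (V : finType) (r : rel V) (e : {set V}) :
  reflect (exists x y, [/\ x != y, r x y & e = [set x; y]])
          (e \in edges_of_rel r).
Proof.
apply: (iffP imsetP) => [[[x y]] | [x [y [xy rxy ->]]]].
  by rewrite inE /= => /andP[xy rxy] ->; exists x, y.
by exists (x, y) => //; rewrite inE /= xy.
Qed.

Lemma in_edges_complete (V : finType) (e : {set V}) :
  (e \in edges (complete V)) = (#|e| == 2).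
Proof.
apply/edges_of_relP/cards2P => [[x [y [xy _ ->]]] | [x [y [xy ->]]]];
  by exists x, y.
Qed.

Lemma adjC (V : finType) (G : sgraph V) x y : adj G x y = adj G y x.
Proof. by rewrite /adj setUC. Qed.

Lemma adj_neq (V : finType) (G : sgraph V) x y : adj G x y -> x != y.
Proof. by move/edges_card2; rewrite cards2; case: (x != y). Qed.

Lemma uniq_map_inj_in (T1 T2 : eqType) (h : T1 -> T2) (s : seq T1) :
  uniq (map h s) -> {in s &, injective h}.
Proof.
elim: s => [|x s IH] //= /andP[xs us] y z.
rewrite !inE => /orP[/eqP-> | ys] /orP[/eqP-> | zs] hyz //.
- by case/negP: xs; rewrite hyz map_f.
- by case/negP: xs; rewrite -hyz map_f.
- exact: IH.
Qed.

(** * Forward-monochromatic and forward-rainbow sequences *)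

Section ForwardSequences.
Variables (V C : finType) (c : {set V} -> C).

(** [P] is imposed, for each entry of [w], on the colours of the edges to later entries: with
    [constant] each entry has one colour ahead of it, with [uniq] each colour at most once. *)
Fixpoint forward (P : pred (seq C)) (w : seq V) : bool :=
  if w is x :: w' then P [seq c [set x; y] | y <- w'] && forward P w' else true.

Lemma forward_uniq_cat (w1 w2 : seq V) x :
  forward uniq (w1 ++ w2) -> x \in w1 -> uniq [seq c [set x; y] | y <- w2].
Proof.
elim: w1 => [|z w1 IH] //= /andP[+ fw]; rewrite inE => + /orP[/eqP-> | xw].
  by rewrite map_cat cat_uniq => /and3P[].
by move=> _; exact: IH.
Qed.

End ForwardSequences.

(** If no fibre has more than [p] elements, there are more than [q] values, and [W'] takes one
    representative of each. *)
Lemma pigeonhole_fibre (T C : finType) (h : T -> C) (W : {set T}) p q :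
  p * q < #|W| ->
  (exists a, p < #|[set x in W | h x == a]|) \/
  (exists2 W' : {set T}, W' \subset W & q < #|W'| /\ {in W' &, injective h}).
Proof.
move=> pqW; case: (boolP [exists a, p < #|[set x in W | h x == a]|]).
  by move/existsP; left.
rewrite negb_exists => /forallP small; right.
have /card_gt0P[x0 _] : 0 < #|W| by exact: leq_ltn_trans pqW.
pose g y := odflt x0 [pick x in W | h x == y].
have gP y : y \in h @: W -> g y \in W /\ h (g y) = y.
  case/imsetP=> x xW ->; rewrite /g.
  by case: pickP => [z /andP[? /eqP //]|/(_ x)]; rewrite xW eqxx.
exists (g @: (h @: W)).
  by apply/subsetP=> _ /imsetP[y /gP[gyW _] ->].
split; last first.
  move=> _ _ /imsetP[y /gP[_ hy] ->] /imsetP[z /gP[_ hz] ->].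
  by rewrite hy hz => ->.
rewrite card_in_imset; last first.
  by move=> y z /gP[_ hy] /gP[_ hz] gyz; rewrite -hy -hz gyz.
rewrite ltnNge; apply/negP => leq.
move: pqW; rewrite ltnNge => /negP; apply.
rewrite -sum1_card (partition_big_imset h) /=.
apply: (@leq_trans (\sum_(y in h @: W) p)); last first.
  by rewrite sum_nat_const mulnC leq_mul2l leq orbT.
apply: leq_sum => y _; rewrite sum1_card leqNgt.
apply: contra (small y); rewrite -cardsE.
by congr (_ < #|pred_of_set _|); apply/setP=> x; rewrite !inE.
Qed.

(** Induction on [a] and [b], with a bound independent of the number of colours. At a vertex [v],
    either many edges share a colour or many have different colours; the sequence found among their
    other ends is extended by [v], unless it is of the other kind and already long enough. *)
Lemma forward_ramsey a b : exists N : nat,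
  forall (V C : finType) (c : {set V} -> C) (W : {set V}), N <= #|W| ->
  exists w : seq V, [/\ uniq w, {subset w <= W} &
    (size w = a /\ forward c (@constant C) w) \/
    (size w = b /\ forward c uniq w)].
Proof.
elim: a b => [|a IHa] b.
  by exists 0 => V C c W _; exists [::]; split=> //; left.
elim: b => [|b [Nb IHb]].
  by exists 0 => V C c W _; exists [::]; split=> //; right.
have [Na {}IHa] := IHa b.+1.
(* One unit pays for [v], the other for the strict inequality in the pigeonhole. *)
exists (Na * Nb).+2 => V C c W NW.
have /card_gt0P[v vW] : 0 < #|W| by exact: leq_trans NW.
have : Na * Nb < #|W :\ v| by move: NW; rewrite (cardsD1 v) vW.
have sub (W' : {set V}) w : W' \subset W :\ v -> uniq w -> {subset w <= W'} ->
    uniq (v :: w) /\ {subset v :: w <= W}.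
  move=> /subsetP W'W uw wW'; split=> /= [|x].
    by rewrite uw andbT; apply/negP => /wW'/W'W; rewrite !inE eqxx.
  by rewrite inE => /predU1P[-> // | /wW'/W'W /setD1P[]].
case/(@pigeonhole_fibre _ _ (fun x => c [set v; x])) => [[d] | [W' W'W []]] cW'.
  set W' := [set _ in _ | _] in cW'.
  have W'W : W' \subset W :\ v by apply/subsetP=> x; rewrite inE => /andP[].
  have [w [uw wW' [[sw fw] | fw]]] := IHa V C c W' (ltnW cW'); last first.
    exists w; split=> //; last by right.
    by move=> x /wW'/(subsetP W'W)/setD1P[].
  have [uvw vwW] := sub _ _ W'W uw wW'.
  exists (v :: w); split=> //; left; rewrite /= sw fw andbT; split=> //.
  apply/(@all_pred1_constant _ d)/allP => _ /mapP[x /wW' + ->].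
  by rewrite inE => /andP[].
move=> injW'; have [w [uw wW' fw]] := IHb V C c W' (ltnW cW').
have [uvw vwW] := sub _ _ W'W uw wW'.
case: fw => -[sw fw].
  exists w; split=> //; last by left.
  by move=> x /wW'/(subsetP W'W)/setD1P[].
exists (v :: w); split=> //; right; rewrite /= sw fw andbT; split=> //.
by rewrite map_inj_in_uniq // => x y /wW' xW /wW' yW; exact: injW'.
Qed.

(** * Rainbow trees *)

Section Trees.
Variable T : finType.

(* A tree is encoded by its root [r] and the list [es] of its pairs
   (vertex, parent), the vertex attached last coming first. *)
Definition verts (r : T) (es : seq (T * T)) : seq T := rcons (unzip1 es) r.

Fixpoint grown (r : T) (es : seq (T * T)) : bool :=
  if es is (x, p) :: es' then
    [&& x \notin verts r es', p \in verts r es' & grown r es']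
  else true.

Lemma grown_uniq r es : grown r es -> uniq (verts r es).
Proof. by elim: es => [|[x p] es IH] //= /and3P[-> _ /IH]. Qed.

Lemma size_verts r es : size (verts r es) = (size es).+1.
Proof. by rewrite size_rcons size_map. Qed.

Lemma grown_mem r es x p :
  grown r es -> (x, p) \in es -> x \in verts r es /\ p \in verts r es.
Proof.
elim: es => [|[y q] es IH] //= /and3P[_ qv /IH{}IH].
rewrite inE => /predU1P[[-> ->] | /IH[xv pv]]; rewrite !inE.
  by rewrite eqxx [q \in _]qv orbT.
by rewrite [x \in _]xv [p \in _]pv !orbT.
Qed.

Lemma mem_verts r es : grown r es -> (size es).+1 = #|T| ->
  forall x, x \in verts r es.
Proof.
move=> ges ses; suff H : verts r es =i enum T by move=> x; rewrite H mem_enum.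
apply/subset_cardP; last by apply/subsetP=> y; rewrite mem_enum.
rewrite (card_uniqP (grown_uniq ges)) (card_uniqP (enum_uniq T)).
by rewrite size_verts -cardE.
Qed.

Lemma closed_connected_full (G : sgraph T) (S : {set T}) r :
  connected G -> r \in S -> 
  (forall x y, x \in S -> adj G x y -> y \in S) -> S = setT.
Proof.
move=> [_ conn] rS cl; apply/setP => x; rewrite inE.
rewrite -(@closed_connect _ (adj G) (mem S) _ r) //.
by move=> u v uv; apply/idP/idP => [/cl|/cl]; apply => //; rewrite adjC.
Qed.

(** Two different neighbours of [x] joined by a path inside [S], which avoids [x], would close a
    cycle through [x]. *)
Lemma acyclic_unique_neighbour (G : sgraph T) (S : {pred T}) x u v :
  acyclic G -> x \notin S -> u \in S -> adj G x u -> adj G x v ->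
  (exists q, [/\ path (adj G) u q, last u q = v & {subset q <= S}]) ->
  u = v.
Proof.
move=> acG xS uS xu xv [q [pq lq qS]].
case/shortenP: pq lq => q' pq' uq' sq' lq'.
case: q' => [|y q'] in pq' uq' sq' lq' *; first exact: lq'.
case: (acG [:: x, u, y & q']) => //; apply/andP; split.
  rewrite /cycle rcons_path; apply/andP; split; first by apply/andP.
  by rewrite -[last x _]/(last u (y :: q')) lq' adjC.
rewrite cons_uniq uq' andbT; apply: contra xS.
by rewrite inE => /predU1P[-> // | /sq'/qS].
Qed.

Definition joined (G : sgraph T) (S : {pred T}) : Prop :=
  forall u v, u \in S -> v \in S ->
  exists q, [/\ path (adj G) u q, last u q = v & {subset q <= S}].

(** Vertices are attached one at a time, keeping the current set connected. By acyclicity a new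
    vertex has a single neighbour in it, so the recorded pairs exhaust the edges. *)
Lemma tree_grown (G : sgraph T) : is_tree G ->
  exists r es, [/\ grown r es, (size es).+1 = #|T| &
    forall x y, adj G x y -> ((x, y) \in es) || ((y, x) \in es)].
Proof.
move=> [cG acG]; have [/card_gt0P[r _] _] := cG; exists r.
suff grow m : m < #|T| -> exists es, [/\ grown r es, size es = m,
     joined G (mem (verts r es)) & 
     {in verts r es &, forall x y,
        adj G x y -> ((x, y) \in es) || ((y, x) \in es)}].
  have T0 : 0 < #|T| by case: cG.
  have [|es [g s _ e]] := grow #|T|.-1; first by rewrite prednK.
  have vT := mem_verts g (etrans (congr1 S s) (prednK T0)).
  by exists es; split=> //; rewrite ?s ?prednK // => x y; apply: e.
elim: m => [|m IH] mT.
  exists [::]; split=> //.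
    by move=> u v; rewrite !inE => /eqP-> /eqP->; exists [::].
  by move=> x y; rewrite !inE => /eqP-> /eqP-> /adj_neq; rewrite eqxx.
have [es [ges ses jes ees]] := IH (ltnW mT).
have [x [p [xv pv xp]]] :
    exists x p, [/\ x \notin verts r es, p \in verts r es & adj G x p].
  case: (boolP [exists x, exists p,
     [&& x \notin verts r es, p \in verts r es & adj G x p]]).
    by move/existsP=> [x /existsP[p /and3P[]]]; exists x, p.
  move=> nx; have /setP ST : [set x in verts r es] = setT.
    apply: (@closed_connected_full G _ r) => //.
      by rewrite inE mem_rcons mem_head.
    move=> p x; rewrite !inE => pv px; case: (boolP (x \in _)) => // xv.
    case/negP: nx; apply/existsP; exists x; apply/existsP; exists p.
    by rewrite xv pv adjC.
  have : #|T| <= #|verts r es|.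
    by apply: subset_leq_card; apply/subsetP=> y _; move: (ST y); rewrite !inE.
  rewrite leqNgt => /negP[]; apply: leq_ltn_trans mT.
  by apply: leq_trans (card_size _) _; rewrite size_verts ses.
exists ((x, p) :: es); rewrite /= -/(verts r es) ses; split=> //.
- by rewrite xv pv.
- move=> u v; rewrite /verts !inE -/(verts _ _).
  have sub (q : seq T) : {subset q <= verts r es} ->
      {subset q <= mem (verts r ((x, p) :: es))}.
    by move=> qs y /qs yv; rewrite !inE [_ \in rcons _ _]yv orbT.
  case/predU1P=> [-> | uv] /predU1P[-> | vv].
  + by exists [::].
  + have [q [pq lq qs]] := jes p v pv vv.
    exists (p :: q); split=> //=; first by rewrite xp.
    by apply: sub => y; rewrite inE => /predU1P[->|/qs].
  + have [q [pq lq qs]] := jes u p uv pv.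
    exists (rcons q x); rewrite rcons_path last_rcons pq lq adjC xp; split=> //.
    move=> y; rewrite mem_rcons inE => /predU1P[-> | /(sub _ qs) //].
      exact: mem_head.
  + by have [q [pq lq /sub qs]] := jes u v uv vv; exists q.
move=> u v; rewrite /verts !inE -/(verts _ _).
have uniqp y : y \in verts r es -> adj G x y -> y = p.
  move=> yv xy.
  by apply: (@acyclic_unique_neighbour G (mem (verts r es)) x) => //; apply: jes.
case/predU1P=> [-> | uv] /predU1P[-> | vv].
- by move/adj_neq; rewrite eqxx.
- by move/(uniqp _ vv)->; rewrite eqxx.
- by rewrite adjC => /(uniqp _ uv) ->; rewrite !eqxx !orbT.
- by move/(ees _ _ uv vv)/orP=> [->|->]; rewrite !orbT.
Qed.

Variables (V C : finType) (c : {set V} -> C).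

Definition edge_colours (f : T -> V) (es : seq (T * T)) : seq C :=
  [seq c [set f e.1; f e.2] | e <- es].

Lemma eq_edge_colours r (f g : T -> V) es : grown r es ->
  {in verts r es, f =1 g} -> edge_colours f es = edge_colours g es.
Proof.
move=> ges fg; apply/eq_in_map => -[x p] /(grown_mem ges)[xv pv] /=.
by rewrite !fg.
Qed.

(** The vertices are laid along [w] with the last attached first, so parents lie ahead of their
    children. All edges from a new vertex into the rest of [w] have one colour, and a tree edge
    there of that colour would complete a monochromatic triangle. *)
Lemma embed_constant r es (w : seq V) :
  (forall x y z, uniq [:: x; y; z] ->
    c [set x; y] = c [set y; z] -> c [set x; z] != c [set x; y]) ->
  grown r es -> uniq w -> size w = (size es).+1 ->
  forward c (@constant C) w ->
  exists f : T -> V, map f (verts r es) = w /\ uniq (edge_colours f es).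
Proof.
move=> notri; elim: es w => [|[x p] es IH] w /=.
  by case: w => [|v []] // _ _ _ _; exists (fun _ => v).
case: w => // v w /and3P[xv pv ges] /andP[vw uw] [sw] /andP[cw fw].
have [f [fE uf]] := IH w ges uw sw fw.
pose g y := if y == x then v else f y.
have gf : {in verts r es, g =1 f}.
  by move=> y; rewrite /g; case: eqP => // -> /(negP xv).
exists g; split.
  by rewrite /verts /= -/(verts r es) {1}/g eqxx -fE; congr (_ :: _); apply/eq_in_map.
rewrite {1}/g eqxx -/(edge_colours g es) (eq_edge_colours ges gf) uf andbT gf //.
have fw_in y : y \in verts r es -> f y \in w by move=> yv; rewrite -fE map_f.
have cst y z : y \in w -> z \in w -> c [set v; y] = c [set v; z].
  case/(constantP (c [set v; y])): cw => d cwE yw zw.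
  have dE u : u \in w -> c [set v; u] = d.
    move=> uw'; have := map_f (fun y => c [set v; y]) uw'.
    by rewrite cwE => /nseqP[].
  by rewrite !dE.
apply/mapP => -[[y q] yq /= E].
have [yv qv] := grown_mem ges yq.
have yq' : y != q.
  elim: (es) ges yq {E gf xv pv fE uf fw_in IH sw yv qv} => //=.
  move=> [z m] es' IH' /and3P[zv mv /IH'{}IH'].
  by rewrite inE => /predU1P[[-> ->] | /IH' //]; apply: contraNneq zv => ->.
have fyq : f y != f q.
  apply: contra yq' => /eqP fyq; apply/eqP.
  by apply: (@uniq_map_inj_in _ _ f (verts r es)); rewrite ?fE.
have := notri v (f y) (f q).
rewrite /= !inE !negb_or fyq !andbT.
have -> : v != f y by apply: contraNneq vw => ->; exact: fw_in.
have -> : v != f q by apply: contraNneq vw => ->; exact: fw_in.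
rewrite -E (cst (f q) (f y)) ?fw_in // eqxx => /(_ isT) H.
by have := H (cst _ _ (fw_in _ yv) (fw_in _ pv)).
Qed.

(** Greedy embedding with a fresh block of [k] entries of [w] for every vertex. The image of the
    parent lies in an earlier block, so its [k] edges into the new block have different colours, and
    fewer than [k] colours are in use. *)
Lemma embed_uniq r es (w : seq V) k :
  grown r es -> uniq w -> size es < k -> k * (size es).+1 <= size w ->
  forward c uniq w ->
  exists f : T -> V,
    [/\ {in verts r es, forall x, f x \in take (k * (size es).+1) w},
        uniq (map f (verts r es)) & uniq (edge_colours f es)].
Proof.
move=> + uw + + fw; elim: es => [|[x p] es IH] /=.
  rewrite muln1 => _; case: k w {uw fw} => // k [|v w] // _ _.
  by exists (fun _ => v); split=> // y; rewrite mem_head.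
move=> /and3P[xv pv ges] esk kw.
have kw' : k * (size es).+1 <= size w.
  by apply: leq_trans kw; rewrite leq_mul2l leqnSn orbT.
have [f [fw' uf uc]] := IH ges (ltnW esk) kw'.
set m := k * (size es).+1 in fw' kw'.
pose q := take k (drop m w).
have wE : take (k * (size es).+2) w = take m w ++ q.
  by rewrite mulnS addnC takeD.
have sq : size q = k.
  by rewrite size_takel // size_drop; move: kw; rewrite mulnS -/m; lia.
have uq : uniq [seq c [set f p; z] | z <- q].
  apply: (@forward_uniq_cat _ _ c (take m w)); last exact: fw'.
  rewrite -wE; elim: (k * _) (w) fw => [|n IHn] [|y w'] //= /andP[uy fy].
  by rewrite IHn // andbT map_take take_uniq.
have [z zq zc] : exists2 z, z \in q & c [set f p; z] \notin edge_colours f es.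
  case: (boolP (has (fun z => c [set f p; z] \notin edge_colours f es) q)).
    by move/hasP.
  move/hasPn => H.
  have : size [seq c [set f p; z] | z <- q] <= size (edge_colours f es).
    by apply: uniq_leq_size uq _ => _ /mapP[z /H /negPn ? ->].
  by rewrite !size_map sq leqNgt; move: (ltnW esk) => ->.
have zw : z \notin take m w.
  have : uniq (take m w ++ q) by rewrite -wE take_uniq.
  by rewrite cat_uniq => /and3P[_ /hasPn/(_ _ zq)].
pose g y := if y == x then z else f y.
have gf : {in verts r es, g =1 f}.
  by move=> y; rewrite /g; case: eqP => // -> /(negP xv).
exists g; rewrite wE /verts /= -/(verts r es) -/(edge_colours g es).
have gx : g x = z by rewrite /g eqxx.
rewrite (eq_edge_colours ges gf) uc gx (gf p) // setUC zc.
split=> // [y|].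
  rewrite inE mem_cat => /predU1P[-> | yv]; first by rewrite gx zq orbT.
  by rewrite gf // fw'.
have -> : [seq g i | i <- verts r es] = map f (verts r es) by apply/eq_in_map.
rewrite uf andbT; apply: contra zw => /mapP[y yv ->]; exact: fw'.
Qed.

End Trees.

(** Both outcomes of [forward_ramsey] contain the tree: a forward-constant sequence of length [k]
    suffices, and a forward-rainbow one of length [k * k] has a block for each vertex. *)
Lemma rainbow_tree k : exists N : nat,
  forall (V C : finType) (c : {set V} -> C) (W : {set V}),
  (forall x y z, uniq [:: x; y; z] ->
    c [set x; y] = c [set y; z] -> c [set x; z] != c [set x; y]) ->
  N <= #|W| ->
  forall (T : finType) (G : sgraph T), is_tree G -> #|T| = k ->
  exists f : T -> V, [/\ injective f, forall x, f x \in W &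
    {in edges G &, injective (fun e : {set T} => c (f @: e))}].
Proof.
have [N NP] := forward_ramsey k (k * k); exists N => V C c W notri NW T G tG Tk.
have [r [es [ges ses eG]]] := tree_grown tG.
have [w [uw wW fw]] := NP V C c W NW.
have [f [fW uf uc]] : exists f : T -> V,
   [/\ {in verts r es, forall x, f x \in W}, uniq (map f (verts r es)) &
       uniq (edge_colours c f es)].
  case: fw => -[sw fw].
    have [|f [fE uf]] := embed_constant notri ges uw _ fw.
      by rewrite sw ses Tk.
    exists f; split=> //; last by rewrite fE.
    by move=> x xv; apply: wW; rewrite -fE map_f.
  have [|| f [fE uf uc]] := embed_uniq (k := k) ges uw _ _ fw.
  - by rewrite -Tk -ses.
  - by rewrite ses Tk sw.
  by exists f; split=> // x /fE /mem_take /wW.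
have vT := mem_verts ges ses.
exists f; split=> [x y|x|e e' eE e'E].
- exact: (uniq_map_inj_in uf).
- exact: fW.
have esP (e0 : {set T}) : e0 \in edges G ->
    exists2 p, p \in es & e0 = [set p.1; p.2].
  move=> e0G; have /eqP/cards2P[x [y [xy E]]] := edges_card2 e0G.
  have /eG/orP[] : adj G x y by rewrite /adj -E.
    by move=> H; exists (x, y).
  by move=> H; exists (y, x); rewrite //= setUC.
have [p pes ->] := esP e eE; have [p' p'es ->] := esP e' e'E.
rewrite !imsetU1 !imset_set1 => cE.
by rewrite (uniq_map_inj_in uc pes p'es cE).
Qed.

(** * Dependent random choice *)

(** The difference of the sides is (x^k - y^k)(x - y), whose factors never have opposite signs. *)
Lemma chebyshev_expn k x y :
  x ^ k * y + y ^ k * x <= x ^ k.+1 + y ^ k.+1.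
Proof.
wlog xy : x y / x <= y => [H|].
  by case: (leqP x y) => [|/ltnW] /H //; rewrite addnC [X in _ <= X]addnC.
have /subnKC <- := xy; set d := y - x.
have : x ^ k <= (x + d) ^ k by case: k => // k; rewrite leq_exp2r // leq_addr.
rewrite !expnS; nia.
Qed.

(** The power mean inequality cleared of denominators; the induction step sums [chebyshev_expn] over
    all pairs. *)
Lemma expn_sum_le (I : finType) (d : I -> nat) k :
  (\sum_i d i) ^ k.+1 <= #|I| ^ k * \sum_i d i ^ k.+1.
Proof.
elim: k => [|k IH].
  by rewrite expn1 mul1n; apply: leq_sum => i _; rewrite expn1.
set D := \sum_i d i in IH *.
rewrite [D ^ _]expnSr; apply: (leq_trans (leq_mul IH (leqnn D))).
rewrite [#|I| ^ k.+1]expnSr -!mulnA leq_mul2l; apply/orP; right.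
rewrite -(leq_pmul2l (isT : 0 < 2)).
have -> : 2 * ((\sum_i d i ^ k.+1) * D) =
    \sum_i \sum_j (d i ^ k.+1 * d j + d j ^ k.+1 * d i).
  under [RHS]eq_bigr => i _ do rewrite big_split /= -big_distrr -big_distrl /=.
  rewrite big_split /= -big_distrl -big_distrr /= -/D; lia.
have -> : 2 * (#|I| * \sum_i d i ^ k.+2) =
    \sum_i \sum_j (d i ^ k.+2 + d j ^ k.+2).
  under [RHS]eq_bigr => i _ do rewrite big_split /= sum_nat_const.
  by rewrite big_split /= sum_nat_const -big_distrr /= addnn -mul2n.
by apply: leq_sum => i _; apply: leq_sum => j _; exact: chebyshev_expn.
Qed.

(** Average over all [s]-tuples [z], with [U z] the common in-neighbourhood of [z]. The sizes of
    [U z] sum to at least |A|^s / |V|^(s-1), while the [s]-sets in them with fewer than [b] common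
    out-neighbours number at most |V|^s b^s in total. So some [U z] has at least [a] more elements
    than such subsets, and one vertex of each is deleted. *)
Lemma dependent_random_choice (V : finType) (A : {set V * V}) (s a b : nat) :
  (#|V| ^ s) * #|V| ^ s.-1 * (a + b ^ s) < #|A| ^ s ->
  exists2 U : {set V}, a <= #|U| &
    forall S : {set V}, S \subset U -> #|S| = s ->
      b <= #|[set y | [forall x in S, (x, y) \in A]]|.
Proof.
(* For [s = 0] the hypothesis reads a + 1 < 1. *)
case: s => [|s]; first by rewrite !mul1n expn0; lia.
move=> sizeA.
pose N (S : {set V}) := [set y | [forall x in S, (x, y) \in A]].
pose bad := [set S : {set V} | (#|S| == s.+1) && (#|N S| < b)].
pose U (z : {ffun 'I_s.+1 -> V}) := [set x | [forall i, (x, z i) \in A]].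
pose d x := #|[set y | (x, y) \in A]|.
have sumd : \sum_x d x = #|A|.
  rewrite -sum1_card (partition_big fst predT) //=; apply: eq_bigr => x _.
  rewrite /d -sum1_card (reindex_onto (fun y => (x, y)) snd) /=.
    by apply: eq_bigl => y; rewrite inE !eqxx !andbT.
  by move=> [u v] /andP[_ /eqP /= ->].
have sumU : \sum_z #|U z| = \sum_x d x ^ s.+1.
  under eq_bigr => z _ do rewrite -sum1_card.
  rewrite (exchange_big_dep predT) //=; apply: eq_bigr => x _.
  rewrite sum1_card /d -[s.+1 in RHS]card_ord -card_ffun_on.
  apply: eq_card => z.
  rewrite [LHS]inE inE; apply/forallP/ffun_onP => H i; have := H i; by rewrite inE.
(* A bad set lies in [U z] only if all entries of [z] are among its fewer than [b] common
   out-neighbours. *)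
have sumbad : \sum_z #|[set S in bad | S \subset U z]| <= #|V| ^ s.+1 * b ^ s.+1.
  under eq_bigr => z _ do rewrite -sum1_card.
  rewrite (exchange_big_dep (mem bad)) /=; last first.
    by move=> z S _; rewrite inE => /andP[].
  apply: (@leq_trans (\sum_(S in bad) b ^ s.+1)); last first.
    rewrite sum_nat_const leq_mul2r; apply/orP; right.
    apply: leq_trans (_ : 'C(#|V|, s.+1) <= _).
      rewrite -card_draws; apply: subset_leq_card.
      by apply/subsetP=> S; rewrite !inE => /andP[].
    apply: leq_trans (_ : #|V| ^_ s.+1 <= _).
      by rewrite -bin_ffact leq_pmulr // fact_gt0.
    rewrite ffact_prod -[X in _ <= _ ^ X]card_ord -prod_nat_const.
    by apply: leq_prod => i _; apply: leq_subr.
  apply: leq_sum => S; rewrite inE => /andP[_ NS].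
  rewrite sum1_card.
  apply: (@leq_trans #|ffun_on (mem (N S)) : pred {ffun 'I_s.+1 -> V}|).
    apply: subset_leq_card; apply/subsetP=> z.
    rewrite [_ \in _]inE => /andP[_ /subsetP SU]; apply/ffun_onP => i.
    by rewrite inE; apply/forall_inP => x /SU; rewrite inE => /forallP.
  by rewrite card_ffun_on card_ord leq_exp2r // ltnW.
have [z az] : exists z, a + #|[set S in bad | S \subset U z]| <= #|U z|.
  apply/existsP; apply: contraLR sizeA.
  rewrite negb_exists => /forallP Uz; rewrite -leqNgt -sumd.
  apply: (leq_trans (expn_sum_le d s)); rewrite /= mulnAC.
  rewrite [X in X <= _]mulnC leq_mul2r; apply/orP; right; rewrite -sumU.
  apply: (@leq_trans (\sum_z (a + #|[set S in bad | S \subset U z]|))).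
    by apply: leq_sum => z _; rewrite ltnW // ltnNge.
  rewrite big_split /= sum_nat_const card_ffun card_ord.
  by rewrite mulnDr leq_add2l.
(* The vertex of [S] to delete; the default [z ord0] is never taken, since bad sets are nonempty. *)
pose r (S : {set V}) := odflt (z ord0) [pick x in S].
pose del := [set r S | S in [set S in bad | S \subset U z]].
exists (U z :\: del).
  have cdel : #|del| <= #|[set S in bad | S \subset U z]|.
    exact: leq_imset_card.
  have : #|U z :&: del| <= #|del| by rewrite subset_leq_card ?subsetIr.
  rewrite cardsD; lia.
move=> S SU Ss; rewrite leqNgt; apply/negP => NS.
have rdel : r S \in del.
  apply: imset_f; rewrite !inE Ss eqxx NS /=.
  by apply: subset_trans SU _; exact: subsetDl.
have : r S \in S.
  rewrite /r; case: pickP => [x //|S0].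
  have /card_gt0P[x xS] : 0 < #|S| by rewrite Ss.
  by have := S0 x; rewrite xS.
by move/(subsetP SU); rewrite inE rdel.
Qed.

(** * The upper bound *)

Lemma card_setType (V : finType) : #|{set V}| = 2 ^ #|V|.
Proof. by rewrite -[RHS](congr1 _ (cardsT V)) -card_powerset powersetT cardsT. Qed.

(** The arc from the centre [x] to the leaf [y] will represent the colour [a]. *)
Lemma star_colouring_centre (V C : finType) (c : {ffun {set V} -> C}) :
  star_colouring (complete V) c ->
  forall a, a \in colours (complete V) c -> exists x y : V,
    [/\ x != y, c [set x; y] = a &
        forall e : {set V}, #|e| = 2 -> c e = a -> x \in e].
Proof.
move=> /forall_inP star a /star /existsP[x /existsP[L]].
move=> /and3P[xL /set0Pn[y yL] /eqP E].
have xy : x != y by apply: contraNneq xL => ->.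
exists x, y; split=> // [|e e2 ca].
  have : [set x; y] \in colour_class (complete V) c a.
    by rewrite E; apply: imset_f.
  by rewrite inE => /andP[_ /eqP].
have : e \in colour_class (complete V) c a.
  by rewrite inE in_edges_complete e2 ca !eqxx.
by rewrite E => /imsetP[z _ ->]; rewrite set21.
Qed.

(** No vertex lies on all three edges of a triangle. *)
Lemma star_colouring_no_triangle (V C : finType) (c : {ffun {set V} -> C}) :
  star_colouring (complete V) c -> forall x y z, uniq [:: x; y; z] ->
  c [set x; y] = c [set y; z] -> c [set x; z] != c [set x; y].
Proof.
move=> star x y z; rewrite /= !inE negb_or andbT => /andP[/andP[xy xz] yz] E1.
apply/eqP => E2.
have [|u [_ [_ _ uP]]] := star_colouring_centre star (a := c [set x; y]).
  by apply: imset_f; rewrite in_edges_complete cards2 xy.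
have := uP [set x; y]; rewrite cards2 xy => /(_ erefl erefl).
have := uP [set y; z]; rewrite cards2 yz => /(_ erefl (esym E1)).
have := uP [set x; z]; rewrite cards2 xz => /(_ erefl E2).
rewrite !inE => /orP[]/eqP-> /orP[]/eqP E /orP[]/eqP E'; subst;
  by rewrite ?eqxx in xy xz yz.
Qed.

Lemma edges_joinP (V1 V2 : finType) (T1 : sgraph V1) (T2 : sgraph V2)
    (e : {set V1 + V2}) : e \in edges (join T1 T2) ->
  [\/ exists2 e1, e1 \in edges T1 & e = inl @: e1,
      exists2 e2, e2 \in edges T2 & e = inr @: e2 |
      exists x y, e = [set inl x; inr y]].
Proof.
case/edges_of_relP=> -[x|x] [[y|y] [_ /= xy ->]].
- by apply: Or31; exists [set x; y]; rewrite ?imsetU1 ?imset_set1.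
- by apply: Or33; exists x, y.
- by apply: Or33; exists y, x; rewrite setUC.
- by apply: Or32; exists [set x; y]; rewrite ?imsetU1 ?imset_set1.
Qed.

(** The [s]-th power of a bound of order n^(2-1/s), which keeps it in the natural numbers. *)
Lemma rainbow_join_many_colours s t : 0 < s -> exists K : nat,
  forall (V C : finType) (c : {ffun {set V} -> C}) (V1 V2 : finType)
    (T1 : sgraph V1) (T2 : sgraph V2),
  star_colouring (complete V) c -> is_tree T1 -> is_tree T2 ->
  #|V1| = s -> #|V2| = t ->
  ~~ has_rainbow_copy (join T1 T2) (complete V) c ->
  #|colours (complete V) c| ^ s <= #|V| ^ s * #|V| ^ s.-1 * K.
Proof.
move=> s0; have [a aP] := rainbow_tree s; have [b bP] := rainbow_tree t.
(* [a] vertices suffice to find [T1] and [b] to find [T2]; 2^s bounds the number of edges of [T1],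
   hence of leaves to avoid. *)
exists (a + (b + 2 ^ s) ^ s) => V C c V1 V2 T1 T2 star tT1 tT2 V1s V2t.
apply: contraNT; rewrite -ltnNge => many.
have notri := star_colouring_no_triangle star.
(* Without vertices there are no colours; otherwise [v0] serves as a default. *)
have [v0 _|V0] := pickP V; last first.
  move: many; rewrite (eq_card0 V0) exp0n // !mul0n.
  have -> : #|colours (complete V) c| = 0; last by rewrite exp0n.
  apply: eq_card0 => a0; apply/negP => /imsetP[e /edges_card2].
  by move/eqP/cards2P => [x]; have := V0 x.
have [D DP] : exists D : C -> V * V, forall a, a \in colours (complete V) c ->
    [/\ (D a).1 != (D a).2, c [set (D a).1; (D a).2] = a &
        forall e : {set V}, #|e| = 2 -> c e = a -> (D a).1 \in e].
  have /fin_all_exists[D DP] : forall a0 : C, exists d : V * V,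
    a0 \in colours (complete V) c ->
    [/\ d.1 != d.2, c [set d.1; d.2] = a0 &
        forall e : {set V}, #|e| = 2 -> c e = a0 -> d.1 \in e].
    move=> a0; case: (boolP (a0 \in colours (complete V) c)) => [H | _].
      by have [x [y H']] := star_colouring_centre star H; exists (x, y).
    by exists (v0, v0).
  by exists D.
pose arcs := D @: colours (complete V) c.
(* An arc is recovered from its colour, so different arcs have different colours. *)
have arcE x y : (x, y) \in arcs -> x != y /\ D (c [set x; y]) = (x, y).
  case/imsetP=> a0 /DP[+ + _] E; rewrite -E /= => xy ca.
  by rewrite xy ca.
have card_arcs : #|arcs| = #|colours (complete V) c|.
  apply: card_in_imset => a1 a2 /DP[_ c1 _] /DP[_ c2 _] E.
  by rewrite -c1 -c2 E.
have colP (e : {set V}) : #|e| = 2 -> c e \in colours (complete V) c.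
  by move=> e2; apply: imset_f; rewrite in_edges_complete e2.
have [|U aU UN] := @dependent_random_choice _ arcs s a (b + 2 ^ s).
  by rewrite card_arcs.
have [f1 [inj1 f1U rb1]] := aP _ _ c U notri aU _ T1 tT1 V1s.
pose N := [set y | [forall x in f1 @: setT, (x, y) \in arcs]].
have NP y : y \in N -> forall x, (f1 x, y) \in arcs.
  by rewrite inE => /forall_inP + x; apply; apply: imset_f.
(* Avoiding the chosen leaves of the colours of [T1] keeps these colours off the edges between the
   trees. *)
pose bad := [set (D (c (f1 @: (e : {set V1})))).2 | e in edges T1].
have bN : b <= #|N :\: bad|.
  have : b + 2 ^ s <= #|N|.
    apply: UN; first by apply/subsetP=> _ /imsetP[x _ ->].
    by rewrite card_imset // cardsT.
  have : #|bad| <= 2 ^ s.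
    apply: leq_trans (leq_imset_card _ _) _.
    by rewrite -V1s -card_setType; apply: max_card.
  have : #|N :&: bad| <= #|bad| by rewrite subset_leq_card ?subsetIr.
  rewrite cardsD; lia.
have [f2 [inj2 f2N rb2]] := bP _ _ c _ notri bN _ T2 tT2 V2t.
have f2NP y x : (f1 x, f2 y) \in arcs.
  by apply: NP; have /setDP[] := f2N y.
have f12 x y : f1 x != f2 y by have [] := arcE _ _ (f2NP y x).
pose f : {ffun V1 + V2 -> V} :=
  [ffun u => match u with inl x => f1 x | inr y => f2 y end].
have injf : injective f.
  move=> [x|x] [y|y]; rewrite !ffunE => /eqP.
  - by move/eqP/inj1->.
  - by rewrite (negPf (f12 _ _)).
  - by rewrite eq_sym (negPf (f12 _ _)).
  - by move/eqP/inj2->.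
have fl (e : {set V1}) : f @: (inl @: e) = f1 @: e.
  by rewrite -imset_comp; apply: eq_imset => x; rewrite /= ffunE.
have fr (e : {set V2}) : f @: (inr @: e) = f2 @: e.
  by rewrite -imset_comp; apply: eq_imset => x; rewrite /= ffunE.
have fc x y : f @: [set inl x; inr y] = [set f1 x; f2 y].
  by rewrite imsetU1 imset_set1 !ffunE.
have e1_2 e : e \in edges T1 -> #|f1 @: e| = 2.
  by move=> /edges_card2; rewrite card_imset.
have e2_2 e : e \in edges T2 -> #|f2 @: e| = 2.
  by move=> /edges_card2; rewrite card_imset.
have n1c e1 x y : e1 \in edges T1 -> c (f1 @: e1) <> c [set f1 x; f2 y].
  move=> eT E; have [_ DE] := arcE _ _ (f2NP y x).
  have /setDP[_ /negP] := f2N y; apply.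
  by apply/imsetP; exists e1 => //; rewrite E DE.
(* The chosen centre of the crossing colour is [f1 x], which is on no edge of the image of [T2]. *)
have n2c e2 x y : e2 \in edges T2 -> c (f2 @: e2) <> c [set f1 x; f2 y].
  move=> eT E; have [_ DE] := arcE _ _ (f2NP y x).
  have [_ _ /(_ _ (e2_2 _ eT) erefl)] := DP _ (colP _ (e2_2 _ eT)).
  by rewrite E DE => /imsetP[z _ /eqP]; rewrite (negPf (f12 _ _)).
have n12 e1 e2 : e1 \in edges T1 -> e2 \in edges T2 ->
    c (f1 @: e1) <> c (f2 @: e2).
  move=> eT1 eT2 E.
  have [_ _ H] := DP _ (colP _ (e1_2 _ eT1)).
  have /imsetP[x _ Ex] := H _ (e1_2 _ eT1) erefl.
  have /imsetP[y _ /eqP] := H _ (e2_2 _ eT2) (esym E).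
  by rewrite Ex (negPf (f12 _ _)).
apply/existsP; exists f; apply/andP; split.
  apply/andP; split; first exact/injectiveP.
  apply/subsetP=> _ /imsetP[e /edges_card2 e2 ->].
  by rewrite in_edges_complete card_imset // e2.
apply/dinjectiveP => _ _ /imsetP[e eJ ->] /imsetP[e' e'J ->].
case/edges_joinP: eJ => [[e1 eT ->]|[e1 eT ->]|[x [y ->]]];
case/edges_joinP: e'J => [[e1' e'T ->]|[e1' e'T ->]|[x' [y' ->]]];
rewrite ?fl ?fr ?fc // => E.
- by rewrite (rb1 e1 e1' eT e'T E).
- by case: (n12 _ _ eT e'T E).
- by case: (n1c _ _ _ eT E).
- by case: (n12 _ _ e'T eT (esym E)).
- by rewrite (rb2 e1 e1' eT e'T E).
- by case: (n2c _ _ _ eT E).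
- by case: (n1c _ _ _ e'T (esym E)).
- by case: (n2c _ _ _ e'T (esym E)).
have [_ D1] := arcE _ _ (f2NP y x); have [_ D2] := arcE _ _ (f2NP y' x').
by move: D1; rewrite E D2 => -[-> ->].
Qed.

Lemma ar_star_expn_le s t : 0 < s -> exists K : nat,
  forall (V1 V2 : finType) (T1 : sgraph V1) (T2 : sgraph V2),
  is_tree T1 -> is_tree T2 -> #|V1| = s -> #|V2| = t ->
  forall n, ar_star n (join T1 T2) ^ s <= n ^ s * n ^ s.-1 * K.
Proof.
move=> s0; have [K KP] := rainbow_join_many_colours t s0; exists K.
move=> V1 V2 T1 T2 tT1 tT2 V1s V2t n; rewrite /ar_star.
elim/big_ind: _ => [|x y Hx Hy|c /andP[star rb]]; first by rewrite exp0n.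
  by rewrite /maxn; case: ifP.
by have := KP _ _ c _ _ T1 T2 star tT1 tT2 V1s V2t rb; rewrite card_ord.
Qed.

(** * The lower bound *)

Lemma card_set2I (V : finType) (x y : V) (A : {set V}) : x != y ->
  (#|[set x; y] :&: A| == 1) = (x \in A) (+) (y \in A).
Proof.
move=> xy; rewrite setIUl cardsU -setIIl [[set x] :&: [set y]](_ : _ = set0).
  have c1 z : #|[set z] :&: A| = (z \in A).
    case: (boolP (z \in A)) => zA.
      by rewrite (setIidPl _) ?cards1 ?sub1set.
    by apply/eqP; rewrite cards_eq0 setI_eq0 disjoints1.
  by rewrite set0I cards0 subn0 !c1; case: (x \in A); case: (y \in A).
by apply/setP=> z; rewrite !inE; apply: contraNF xy => /andP[/eqP-> /eqP->].
Qed.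

(** Toggling the membership of [x] in [A] is an involution exchanging the sets that cut [e] with
    those that do not. *)
Lemma card_cutting_sets (V : finType) (e : {set V}) : #|e| = 2 ->
  2 * #|[set A : {set V} | #|e :&: A| == 1]| = 2 ^ #|V|.
Proof.
move=> /eqP/cards2P[x [y [xy ->]]].
have cutE A := card_set2I A xy.
pose flip (A : {set V}) := if x \in A then A :\ x else x |: A.
have flipx A : (x \in flip A) = (x \notin A).
  by rewrite /flip; case: ifP => xA; rewrite !inE eqxx.
have flipy A : (y \in flip A) = (y \in A).
  by rewrite /flip; case: ifP => xA; rewrite !inE [y == x]eq_sym (negPf xy).
have flipK : involutive flip.
  move=> A; rewrite {1}/flip flipx /flip; case: (boolP (x \in A)) => xA /=.
    by rewrite setD1K.
  by rewrite setU1K.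
set B := [set A | _]; have -> : 2 ^ #|V| = #|{set V}| by rewrite card_setType.
rewrite -cardsT -(setUCr B) cardsU setICr cards0 subn0 mul2n -addnn.
congr (_ + _).
rewrite -(card_imset _ (inv_inj flipK)); apply: eq_card => A.
rewrite !inE cutE; apply/imsetP/idP => [[A' + ->]|H].
  by rewrite inE cutE flipx flipy; case: (x \in A'); case: (y \in A').
exists (flip A); last by rewrite flipK.
by rewrite inE cutE flipx flipy; move: H; case: (x \in A); case: (y \in A).
Qed.

(** Averaging over all [A]: each edge is cut by exactly half of them. *)
Lemma half_cut (V : finType) (E : {set {set V}}) :
  (forall e, e \in E -> #|e| = 2) ->
  exists A : {set V}, #|E| <= 2 * #|[set e in E | #|e :&: A| == 1]|.
Proof.
move=> E2; apply/existsP; apply: contraT; rewrite negb_exists => /forallP small.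
have : \sum_(A : {set V}) 2 * #|[set e in E | #|e :&: A| == 1]| <
       \sum_(A : {set V}) #|E|.
  have V0 : 0 < #|{set V}| by rewrite card_setType expn_gt0.
  have H : forall A, (2 * #|[set e in E | #|e :&: A| == 1]|).+1 <= #|E|.
    by move=> A; rewrite ltnNge.
  apply: (@leq_trans
    (\sum_(A : {set V}) (2 * #|[set e in E | #|e :&: A| == 1]|).+1)).
    under [X in _ <= X]eq_bigr do rewrite -addn1.
    rewrite [X in _ < X]big_split -[X in X < _]addn0 ltn_add2l.
    by rewrite sum_nat_const muln1.
  exact: leq_sum.
rewrite -big_distrr /=.
under eq_bigr => A _ do rewrite -sum1_card.
rewrite (exchange_big_dep (mem E)) /=; last first.
  by move=> A e _; rewrite inE => /andP[].
rewrite big_distrr sum_nat_const /=.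
rewrite (eq_bigr (fun _ => 2 ^ #|V|)) => [|e eE].
  by rewrite sum_nat_const card_setType mulnC ltnn.
rewrite -(card_cutting_sets (E2 e eE)) sum1_card; congr (_ * _).
by apply: eq_card => A; rewrite [RHS]inE -[LHS]/(e \in [set _ in _ | _]) inE eE.
Qed.

(** Brings arbitrary colours into the palette of [ar_star]: each class is named by one of its
    edges. *)
Lemma relabel_colouring (V : finType) (C : eqType) (E : {set {set V}})
    (c0 : {set V} -> C) : E != set0 ->
  exists c : {ffun {set V} -> 'I_#|E|},
    {in E &, forall e e', (c e == c e') = (c0 e == c0 e')}.
Proof.
case/set0Pn => e0 e0E.
pose rep e := odflt e0 [pick e' in E | c0 e' == c0 e].
have repE e : e \in E -> rep e \in E /\ c0 (rep e) = c0 e.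
  rewrite /rep => eE; case: pickP => [e' /andP[? /eqP //]|/(_ e)].
  by rewrite eE eqxx.
exists [ffun e => enum_rank_in e0E (rep e)] => e e' eE e'E; rewrite !ffunE.
have [r1 r2] := repE e eE; have [r1' r2'] := repE e' e'E.
apply/eqP/eqP => [/(enum_rank_in_inj r1 r1') E2|E2].
  by rewrite -r2 -r2' E2.
congr enum_rank_in; rewrite /rep.
by congr (odflt _ _); apply: eq_pick => e1; rewrite E2.
Qed.

Lemma enum_from (V : finType) (P : {set V}) k : #|P| = k.+1 ->
  forall p0, p0 \in P -> exists g : 'I_k.+1 -> V,
    [/\ injective g, forall i, g i \in P & forall i, g i = p0 -> i = 0 :> nat].
Proof.
move=> Pk p0 p0P; pose e := p0 :: enum (P :\ p0).
have se : size e = k.+1.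
  by rewrite /= -cardE; move: Pk; rewrite (cardsD1 p0) p0P add1n => -[->].
have ue : uniq e by rewrite /= enum_uniq mem_enum !inE eqxx.
exists (fun i => nth p0 e i); split=> [i j /eqP|i|i].
- by rewrite nth_uniq ?se // => /eqP/val_inj.
- have : nth p0 e i \in e by rewrite mem_nth ?se.
  by rewrite inE => /predU1P[-> // |]; rewrite mem_enum => /setD1P[].
- by move/eqP; rewrite -{2}[p0]/(nth p0 e 0) nth_uniq ?se // => /eqP.
Qed.

(** The only pair that may be missing gets index 0 on both sides; if none is missing, an arbitrary
    pair does. *)
Lemma has_copy_Kst_minus (V : finType) (G : sgraph V) (P Q : {set V}) s t :
  #|P| = s.+1 -> #|Q| = t.+1 -> [disjoint P & Q] ->
  (forall p p' q q', p \in P -> p' \in P -> q \in Q -> q' \in Q ->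
     ~~ adj G p q -> ~~ adj G p' q' -> p = p' /\ q = q') ->
  has_copy (Kst_minus s.+1 t.+1) G.
Proof.
move=> Ps Qt dPQ one.
have [p0 [q0 [p0P q0Q pq0]]] : exists p0 q0, [/\ p0 \in P, q0 \in Q &
    forall p q, p \in P -> q \in Q -> ~~ adj G p q -> p = p0 /\ q = q0].
  case: (boolP [exists p, exists q, [&& p \in P, q \in Q & ~~ adj G p q]]).
    move/existsP=> [p /existsP[q /and3P[pP qQ npq]]]; exists p, q; split=> //.
    by move=> p' q' p'P q'Q npq'; apply: one.
  move=> none; have /card_gt0P[p pP] : 0 < #|P| by rewrite Ps.
  have /card_gt0P[q qQ] : 0 < #|Q| by rewrite Qt.
  exists p, q; split=> // p' q' p'P q'Q npq; case/negP: none.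
  by apply/existsP; exists p'; apply/existsP; exists q'; rewrite p'P q'Q.
have [g [gi gP g0]] := enum_from Ps p0P.
have [h [hi hQ h0]] := enum_from Qt q0Q.
have gh i j : g i != h j.
  by apply/eqP=> E; have /disjointFr/(_ (gP i)) := dPQ; rewrite E hQ.
pose f : {ffun 'I_s.+1 + 'I_t.+1 -> V} :=
  [ffun u => match u with inl i => g i | inr j => h j end].
apply/existsP; exists f; apply/andP; split.
  apply/injectiveP => -[i|j] [i'|j']; rewrite !ffunE => /eqP.
  - by move/eqP/gi->.
  - by rewrite (negPf (gh _ _)).
  - by rewrite eq_sym (negPf (gh _ _)).
  - by move/eqP/hi->.
apply/subsetP=> _ /imsetP[e /edges_of_relP[[i|j] [[i'|j'] [_ //= nij ->]]] ->].
rewrite imsetU1 imset_set1 !ffunE -/(adj G _ _).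
apply: contraR nij => /pq0[] // /g0 -> /h0 ->; by [].
Qed.

(** * Graphs with at most one forward neighbour per vertex *)

Section OneForwardNeighbour.
Variables (J : finType) (F : rel J) (h : J -> nat).
Hypothesis symF : symmetric F.
Hypothesis injh : injective h.
Hypothesis irrF : irreflexive F.
Hypothesis fwdF : forall u v w,
  F u v -> F u w -> h u < h v -> h u < h w -> v = w.

Definition within (S : {set J}) : rel J :=
  [rel x y | [&& F x y, x \in S & y \in S]].

Definition spans (S : {set J}) : Prop :=
  {in S &, forall x y, connect (within S) x y}.

Lemma within_sym (S : {set J}) : symmetric (within S).
Proof. by move=> u v; rewrite /within /= symF [(u \in S) && _]andbC. Qed.

Lemma spans_from (S : {set J}) r :
  (forall x, x \in S -> connect (within S) r x) -> spans S.
Proof.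
move=> rS x y xS yS; apply: connect_trans (rS y yS).
by rewrite sym_connect_sym ?rS //; exact: within_sym.
Qed.

Lemma F_heights u v : F u v -> (h u < h v) || (h v < h u).
Proof.
move=> uv; have : h u != h v by apply: contraTneq uv => /injh ->; rewrite irrF.
by case: ltngtP.
Qed.

Lemma F_fork u v w : F u v -> F u w -> v != w -> (h v < h u) || (h w < h u).
Proof.
move=> uv uw; apply: contraNT; rewrite negb_or => /andP[nv nw].
apply/eqP; apply: (fwdF uv uw).
  by have := F_heights uv; rewrite (negPf nv) orbF.
by have := F_heights uw; rewrite (negPf nw) orbF.
Qed.

(** The lowest vertex would have two forward neighbours; likewise for the square below. *)
Lemma F_no_triangle u v w : F u v -> F v w -> F u w -> False.
Proof.
move=> uv vw uw.
have neq a b : F a b -> a != b by apply: contraTneq => ->; rewrite irrF.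
have := F_fork uv uw (neq _ _ vw).
have [vu wu] : F v u /\ F w u by rewrite !(symF _ u).
have wv : F w v by rewrite symF.
have := F_fork vw vu; rewrite eq_sym (neq _ _ uw) => /(_ isT).
have := F_fork wu wv (neq _ _ uv).
lia.
Qed.

Lemma F_no_square x x' y y' : x != x' -> y != y' ->
  F x y -> F x y' -> F x' y -> F x' y' -> False.
Proof.
move=> xx' yy' xy xy' x'y x'y'.
have := F_fork xy xy' yy'; have := F_fork x'y x'y' yy'.
have [yx yx'] : F y x /\ F y x' by rewrite !(symF y).
have [y'x y'x'] : F y' x /\ F y' x' by rewrite !(symF y').
have := F_fork yx yx' xx'; have := F_fork y'x y'x' xx'.
lia.
Qed.

(* Following forward edges inside [S] from any vertex must end in [u]: the only
   forward edge at [u] leaves [S]. *)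
Lemma leaving_edge_top (S : {set J}) u v w : spans S ->
  u \in S -> v \notin S -> F u v -> h u < h v -> w \in S -> h w <= h u.
Proof.
move=> conS uS vS uv huv wS.
pose up := [rel x y | within S x y && (h x < h y)].
(* A downward step from [x] to [y] prepends [y] to the upward path. An upward step from [x] must be
   the first one of that path, and from [u] itself it would be the edge leaving [S]. *)
have closedup : closed (within S) [pred x | connect up x u].
  apply: intro_closed; first exact/sym_connect_sym/within_sym.
  move=> x y xy; rewrite !inE => xu; have /and3P[Fxy xS yS] := xy.
  have /orP[hxy | hyx] := F_heights Fxy; last first.
    apply: connect_trans xu; apply: connect1.
    by rewrite /up /within /= symF Fxy xS yS.
  have [xu' | xu'] := eqVneq x u.
    rewrite xu' in Fxy hxy.
    by case/negP: vS; rewrite (fwdF uv Fxy huv hxy).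
  case/connectP: xu => -[|z q] /=; first by move=> _ E; rewrite E eqxx in xu'.
  move=> /andP[/andP[/and3P[xz _ _] hxz] pq] E.
  by rewrite (fwdF Fxy xz hxy hxz); apply/connectP; exists q.
have : w \in [pred x | connect up x u].
  by rewrite -(closed_connect closedup (conS u w uS wS)) inE connect0.
rewrite inE => /connectP[q pq ->]; elim: q w pq {wS} => [|z q IH] w //=.
by case/andP=> /andP[_ wz] /IH; exact: (leq_trans (ltnW wz)).
Qed.

(** The lower end of a crossing edge is the highest vertex of its part. Two such edges going up from
    the same part thus share their lower end, hence both ends; going up from different parts, they
    would make heights increase around a cycle. *)
Lemma unique_crossing_edge (P Q : {set J}) p p' q q' :
  spans P -> spans Q -> [disjoint P & Q] ->
  p \in P -> p' \in P -> q \in Q -> q' \in Q -> F p q -> F p' q' ->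
  p = p' /\ q = q'.
Proof.
move=> sP sQ dPQ pP p'P qQ q'Q pq p'q'.
have PQ x : x \in P -> x \notin Q by move/(disjointFr dPQ)->.
have QP x : x \in Q -> x \notin P by move/(disjointFl dPQ)->.
have [qp q'p'] : F q p /\ F q' p' by rewrite !(symF _ p) !(symF _ p').
have /orP[h1 | h1] := F_heights pq; have /orP[h2 | h2] := F_heights p'q'.
- have E : p = p'.
    apply: injh; apply/eqP; rewrite eqn_leq.
    rewrite (leaving_edge_top sP p'P (QP _ q'Q)) //.
    by rewrite (leaving_edge_top sP pP (QP _ qQ)).
  by split=> //; rewrite -E in p'q' h2; exact: fwdF h1 h2.
- have := leaving_edge_top sP pP (QP _ qQ) pq h1 p'P.
  have := leaving_edge_top sQ q'Q (PQ _ p'P) q'p' h2 qQ; lia.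
- have := leaving_edge_top sP p'P (QP _ q'Q) p'q' h2 pP.
  have := leaving_edge_top sQ qQ (PQ _ pP) qp h1 q'Q; lia.
- have E : q = q'.
    apply: injh; apply/eqP; rewrite eqn_leq.
    rewrite (leaving_edge_top sQ q'Q (PQ _ p'P)) //.
    by rewrite (leaving_edge_top sQ qQ (PQ _ pP)).
  by split=> //; rewrite -E in q'p' h2; exact: fwdF h1 h2.
Qed.

End OneForwardNeighbour.

Lemma connected_neighbour (V : finType) (G : sgraph V) x :
  connected G -> 1 < #|V| -> exists y, adj G x y.
Proof.
move=> [_ cG] V1; have [z zx] : exists z, z != x.
  have /card_gt1P[y [z [_ _ yz]]] := V1.
  by have [yx | yx] := eqVneq y x; [exists z; rewrite -yx eq_sym | exists y].
have /connectP[[|y q] /= + E] := cG x z; first by rewrite E eqxx in zx.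
by case/andP=> xy _; exists y.
Qed.

(** * Splitting the join along a cut *)

Section JoinTwoColoured.
Variables (V1 V2 : finType) (T1 : sgraph V1) (T2 : sgraph V2).
Hypotheses (cT1 : connected T1) (cT2 : connected T2).
Hypotheses (V1gt2 : 2 < #|V1|) (V2gt2 : 2 < #|V2|).
Variables (F : rel (V1 + V2)) (h : V1 + V2 -> nat) (side : V1 + V2 -> bool).
Hypothesis symF : symmetric F.
Hypothesis injh : injective h.
Hypothesis irrF : irreflexive F.
Hypothesis fwdF : forall u v w,
  F u v -> F u w -> h u < h v -> h u < h w -> v = w.
Hypothesis sideF : forall u v, u != v -> join_rel T1 T2 u v ->
  side u = side v -> F u v.

Lemma join_spanning_split : exists P Q : {set V1 + V2},
  [/\ #|P| = #|V1| /\ #|Q| = #|V2|, [disjoint P & Q],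
      spans F P /\ spans F Q &
      {in P & Q, forall p q, join_rel T1 T2 p q}].
Proof.
have nb (b1 b2 : bool) : b1 <> b2 -> b2 = ~~ b1 by case: b1 b2 => [] [].
have noT := F_no_triangle symF injh irrF fwdF.
have noS := F_no_square symF injh irrF fwdF.
have F12 x y : side (inl x) = side (inr y) -> F (inl x) (inr y) by exact: sideF.
have F1 x x' : adj T1 x x' -> side (inl x) = side (inl x') ->
    F (inl x) (inl x').
  by move=> xx'; apply: sideF => //; have := adj_neq xx'.
have F2 y y' : adj T2 y y' -> side (inr y) = side (inr y') ->
    F (inr y) (inr y').
  by move=> yy'; apply: sideF => //; have := adj_neq yy'.
have N1 x : exists x', adj T1 x x'.
  by apply: connected_neighbour; rewrite // ltnW.
have N2 y : exists y', adj T2 y y'.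
  by apply: connected_neighbour; rewrite // ltnW.
have mono1 x x' y : adj T1 x x' -> side (inl x) = side (inl x') ->
    side (inr y) = ~~ side (inl x).
  move=> xx' E; apply: nb => E'.
  case: (noT (inl x) (inl x') (inr y)); [exact: F1|apply: F12|apply: F12 => //].
  by rewrite -E.
have mono2 y y' x : adj T2 y y' -> side (inr y) = side (inr y') ->
    side (inl x) = ~~ side (inr y).
  move=> yy' E; apply: nb => E'.
  by case: (noT (inl x) (inr y) (inr y')) => //;
    [exact: F12 | exact: F2 | apply: F12; rewrite -E'].
have /card_gt0P[x1 _] : 0 < #|V1| by apply: ltn_trans V1gt2.
have /card_gt0P[y1 _] : 0 < #|V2| by apply: ltn_trans V2gt2.
have inlI : injective (@inl V1 V2) by move=> ? ? [].
have inrI : injective (@inr V1 V2) by move=> ? ? [].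
(* The case in which the cut separates the two trees. *)
have case1 b : (forall x, side (inl x) = b) -> (forall y, side (inr y) = ~~ b) ->
  exists P Q : {set V1 + V2},
  [/\ #|P| = #|V1| /\ #|Q| = #|V2|, [disjoint P & Q],
      spans F P /\ spans F Q &
      {in P & Q, forall p q, join_rel T1 T2 p q}].
  move=> s1 s2; exists (inl @: setT), (inr @: setT); split.
  - by rewrite !card_imset // !cardsT.
  - rewrite disjoint_subset; apply/subsetP=> _ /imsetP[x _ ->].
    by apply/negP => /imsetP[].
  - split=> _ _ /imsetP[x _ ->] /imsetP[y _ ->].
      have /connectP[q + ->] := proj2 cT1 x y.
      elim: q x => [|z q IH] x //= /andP[xz /IH]; apply: connect_trans.
      by apply: connect1; rewrite /within /= F1 ?s1 ?imset_f.
    have /connectP[q + ->] := proj2 cT2 x y.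
    elim: q x => [|z q IH] x //= /andP[xz /IH]; apply: connect_trans.
    by apply: connect1; rewrite /within /= F2 ?s2 ?imset_f.
  - by move=> _ _ /imsetP[x _ ->] /imsetP[y _ ->].
(* By triangles, an edge of [T1] on one side forces [T2] to the other side; an edge of [T2] then
   forces all of [T1] to the first. *)
have [m1 | m1] := boolP [exists x, exists x',
    adj T1 x x' && (side (inl x) == side (inl x'))].
  have /existsP[x /existsP[x' /andP[xx' /eqP E]]] := m1.
  have s2 y := mono1 x x' y xx' E.
  have [y2 y12] := N2 y1.
  by apply: (case1 (side (inl x))) => // x2; rewrite (mono2 y1 y2) // !s2 ?negbK.
have [m2 | m2] := boolP [exists y, exists y',
    adj T2 y y' && (side (inr y) == side (inr y'))].
  have /existsP[y /existsP[y' /andP[yy' /eqP E]]] := m2.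
  have s1 x := mono2 y y' x yy' E.
  have [x2 x12] := N1 x1.
  by apply: (case1 (~~ side (inr y))) => // y2; rewrite (mono1 x1 x2) // !s1 ?negbK.
(* From here on, [side] alternates along the edges of both trees. *)
have A1 x x' : adj T1 x x' -> side (inl x') = ~~ side (inl x).
  move=> xx'; move: m1; rewrite negb_exists => /forallP/(_ x).
  rewrite negb_exists => /forallP/(_ x'); rewrite xx' /=.
  by case: (side (inl x)) (side (inl x')) => [] [].
have A2 y y' : adj T2 y y' -> side (inr y') = ~~ side (inr y).
  move=> yy'; move: m2; rewrite negb_exists => /forallP/(_ y).
  rewrite negb_exists => /forallP/(_ y'); rewrite yy' /=.
  by case: (side (inr y)) (side (inr y')) => [] [].
have square x x' y y' : x != x' -> side (inl x) = side (inl x') ->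
    side (inr y) = side (inl x) -> side (inr y') = side (inl x) -> y = y'.
  move=> xx' E Ey Ey'; apply/eqP; apply: contraT => yy'.
  by case: (noS (inl x) (inl x') (inr y) (inr y')) => //;
    apply: F12; rewrite ?Ey ?Ey' -?E.
(* Two of at least three vertices of [T1] share a side, on which [square] then allows only one
   vertex of [T2]. *)
have [x2 [x3 [x23 Ex]]] : exists x x', x != x' /\ side (inl x) = side (inl x').
  pose X b := [set x | side (inl x) == b].
  have : 1 < #|X true| \/ 1 < #|X false|.
    have : #|X true| + #|X false| = #|V1|.
      rewrite -(cardsC (X true)); congr (_ + #|pred_of_set _|).
      by apply/setP=> x; rewrite !inE; case: (side _).
    lia.
  by case=> /card_gt1P[x [x' [+ + xx']]]; rewrite !inE => /eqP E /eqP E';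
    exists x, x'; rewrite E E'.
set b := side (inl x2) in Ex.
have [y0 sy0] : exists y0, side (inr y0) = b.
  have [y2 /A2 E] := N2 y1.
  have [E' | E'] := eqVneq (side (inr y1)) b; first by exists y1.
  by exists y2; rewrite E; case: (side _) (b) E' => [] [].
have sy y : y != y0 -> side (inr y) = ~~ b.
  by move=> yy0; apply: nb => E; case/eqP: yy0; apply: (square x2 x3).
have [x0 sx0] : exists x0, side (inl x0) = ~~ b.
  by have [x4 /A1 E] := N1 x2; exists x4.
(* Otherwise [x], [x0] and two vertices of [T2] other than [y0] form a square. *)
have sx x : x != x0 -> side (inl x) = b.
  move=> xx0; apply/eqP; apply: contraT => E.
  have /card_gt1P[y [y' [yy0 y'y0 yy']]] : 1 < #|[set~ y0]|.
    by rewrite cardsC1; move: V2gt2; case: #|V2|.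
  rewrite !inE in yy0 y'y0; case/negP: yy'; apply/eqP.
  by apply: (square x x0) => //; rewrite ?sx0 ?sy //;
    case: (side _) (b) E => [] [].
(* After the exchange, [y0] and [x0] lie on the side of the rest of their new parts, which are
   therefore spanned by stars of [F]. *)
exists (inr y0 |: inl @: [set~ x0]), (inl x0 |: inr @: [set~ y0]).
have yn : inr y0 \notin inl @: [set~ x0] by apply/negP => /imsetP[].
have xn : inl x0 \notin inr @: [set~ y0] by apply/negP => /imsetP[].
split.
- rewrite !cardsU1 yn xn !card_imset // !cardsC1 !add1n !prednK //.
  + exact: ltn_trans V2gt2.
  + exact: ltn_trans V1gt2.
- rewrite disjoint_subset; apply/subsetP=> _ /setU1P[-> | /imsetP[x + ->]].
    by rewrite !inE /=; apply/imsetP => -[y + [E]]; rewrite !inE E eqxx.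
  rewrite !inE => xx0; apply/norP; split.
    by apply: contraNneq xx0 => -[->].
  by apply/imsetP => -[].
- split.
    apply: (@spans_from _ _ symF _ (inr y0)) =>
      _ /setU1P[-> // | /imsetP[x + ->]].
    rewrite !inE => xx0; apply: connect1; rewrite /within /= symF F12 ?sx //.
    by rewrite setU11 setU1r // imset_f // !inE.
  apply: (@spans_from _ _ symF _ (inl x0)) =>
    _ /setU1P[-> // | /imsetP[y + ->]].
  rewrite !inE => yy0; apply: connect1; rewrite /within /= F12 ?sy //.
  by rewrite setU11 setU1r // imset_f // !inE.
move=> p q /setU1P[-> | /imsetP[x + ->]] /setU1P[-> | /imsetP[y + ->]] //=;
  rewrite !inE => n0.
(* A neighbour of [y] in [T2] lies on side [b], so it is [y0]: [T2] is a star. The same holds for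
   [T1] and [x0]. *)
- have [z zy] := N2 y; rewrite adjC (_ : y0 = z) //; apply/eqP; rewrite eq_sym.
  apply: contraT => /sy; rewrite (A2 _ _ zy) (sy y n0).
  by case: (b).
- have [z zx] := N1 x; rewrite (_ : x0 = z) //; apply/eqP; rewrite eq_sym.
  apply: contraT => /sx; rewrite (A1 _ _ zx) (sx x n0).
  by case: (b).
Qed.

End JoinTwoColoured.

(** * The colouring built from an extremal graph *)

Lemma edges_join_adj (V1 V2 : finType) (T1 : sgraph V1) (T2 : sgraph V2) u v :
  (adj (join T1 T2) u v) = (u != v) && join_rel T1 T2 u v.
Proof.
apply/edges_of_relP/andP => [[x [y [xy rxy E]]] | [uv ruv]]; last by exists u, v.
have sym : join_rel T1 T2 y x.
  by case: x y rxy {xy E} => [x|x] [y|y] //=; rewrite adjC.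
have uE : u \in [set x; y] by rewrite -E set21.
have vE : v \in [set x; y] by rewrite -E set22.
have yE : y \in [set u; v] by rewrite E set22.
have xE : x \in [set u; v] by rewrite E set21.
move: uE vE xE yE; rewrite !inE.
by case/orP=> /eqP->; case/orP=> /eqP->;
  rewrite ?eqxx ?orbb ?xy 1?eq_sym ?xy ?(negPf xy) //= 1?eq_sym ?(negPf xy).
Qed.

Lemma ex_Kst_minus_le_ar_star (V1 V2 : finType) (T1 : sgraph V1)
    (T2 : sgraph V2) s t n :
  connected T1 -> connected T2 -> #|V1| = s -> #|V2| = t -> 2 < s -> 2 < t ->
  1 < n -> ex n (Kst_minus s t) <= 2 * ar_star n (join T1 T2).
Proof.
move=> cT1 cT2 V1s V2t s2 t2 n1; apply/bigmax_leqP => G KG.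
have [A halfA] := half_cut (@edges_card2 _ G).
set E' := [set e in edges G | _] in halfA.
apply: leq_trans halfA _; rewrite leq_mul2l /=.
have E'G e : e \in E' -> e \in edges G by rewrite inE => /andP[].
set K := complete 'I_n.
have inK (x y : 'I_n) : ([set x; y] \in edges K) = (x != y).
  by rewrite in_edges_complete cards2; case: (x != y).
have E'K e : e \in E' -> e \in edges K.
  by move=> /E'G/edges_card2 e2; rewrite in_edges_complete e2.
(* Colours are vertex sets at first: a kept edge is its own colour and any other edge gets the
   singleton of its smaller end, so the two kinds never coincide. *)
pose c0 (e : {set 'I_n}) :=
  if e \in E' then e else [set x in e | [forall y in e, x <= y]].
have c0lt (x y : 'I_n) : x < y -> [set x; y] \notin E' ->
    c0 [set x; y] = [set x].
  move=> xy /negPf nE; rewrite /c0 nE; apply/setP=> z; rewrite !inE.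
  apply/andP/eqP => [[/orP[]/eqP -> // /forall_inP/(_ x)] | ->].
    by rewrite !inE eqxx leqNgt xy => /(_ isT).
  rewrite eqxx; split=> //; apply/forall_inP=> w; rewrite !inE.
  by case/orP=> /eqP-> //; exact: ltnW.
have K_lt e : e \in edges K -> exists x y : 'I_n, x < y /\ e = [set x; y].
  rewrite in_edges_complete => /cards2P[x [y [xy ->]]].
  have /orP[] : (x < y) || (y < x) by rewrite -neq_ltn.
    by exists x, y.
  by exists y, x; rewrite setUC.
have c0_set1 e x : e \in edges K -> c0 e = [set x] ->
    exists2 y : 'I_n, x < y & e = [set x; y] /\ e \notin E'.
  move=> eK; have [y [z [yz Ee]]] := K_lt e eK.
  have [eE' | eE'] := boolP (e \in E'); last first.
    by rewrite Ee c0lt -?Ee // => /set1_inj <-; exists z.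
  rewrite /c0 eE' => ex1; move: eK.
  by rewrite in_edges_complete ex1 cards1.
have [c cE] : exists c : {ffun {set 'I_n} -> 'I_#|edges K|},
    {in edges K &, forall e e', (c e == c e') = (c0 e == c0 e')}.
  apply: relabel_colouring; apply/set0Pn.
  by exists [set Ordinal (ltnW n1); Ordinal n1]; rewrite inK.
have c_inj : {in E' &, injective c}.
  move=> e e' eE e'E /eqP; rewrite cE ?E'K // /c0 eE e'E => /eqP; exact.
apply: leq_trans (_ : #|colours K c| <= _).
  rewrite -(card_in_imset c_inj); apply: subset_leq_card.
  by apply/subsetP=> _ /imsetP[e /E'K eK ->]; apply: imset_f.
apply: (@leq_bigmax_cond _ _
  (fun c : {ffun {set 'I_n} -> 'I_#|edges K|} => #|colours K c|)).
apply/andP; split.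
  (* A kept edge is a class by itself; the class of another edge is a star at its smaller end [x],
     with leaves the larger [z] such that [x z] is not kept. *)
  apply/forall_inP => _ /imsetP[e eK ->].
  have [x [y [xy Ee]]] := K_lt e eK.
  have xny : x != y by rewrite neq_ltn xy.
  apply/existsP; exists x; have [eE' | eE'] := boolP (e \in E').
    apply/existsP; exists [set y].
    rewrite imset_set1 -Ee inE xny /=; apply/andP; split.
      by apply/set0Pn; exists y; rewrite inE.
    apply/eqP/setP=> e'; rewrite !inE; apply/andP/eqP => [[e'K]|->]; last by [].
    rewrite cE //; have [e'E' | e'E'] := boolP (e' \in E').
      by rewrite /c0 eE' e'E' => /eqP.
    have [x' [y' [xy' Ee']]] := K_lt e' e'K.
    rewrite Ee' c0lt -?Ee' // /c0 eE' => /eqP ex'; move: eK.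
    by rewrite in_edges_complete -ex' cards1.
  apply/existsP; exists [set z : 'I_n | (x < z) && ([set x; z] \notin E')].
  rewrite inE ltnn /=; apply/andP; split.
    by apply/set0Pn; exists y; rewrite inE xy -Ee.
  have c0e : c0 e = [set x] by rewrite Ee c0lt -?Ee.
  apply/eqP/setP=> e'; rewrite inE; apply/andP/imsetP => [[e'K]|[z + ->]].
    rewrite cE // c0e => /eqP /(c0_set1 _ _ e'K)[z xz [Ee' e'E']].
    by exists z => //; rewrite inE xz -Ee'.
  rewrite inE => /andP[xz nE'].
  have xzK : [set x; z] \in edges K by rewrite inK neq_ltn xz.
  by split=> //; rewrite cE // c0e c0lt.
apply/negP => /existsP[f /andP[/andP[/injectiveP injf fK] /dinjectiveP rb]].
have f2 u v : f @: [set u; v] = [set f u; f v] by rewrite imsetU1 imset_set1.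
have in_copy u v : adj (join T1 T2) u v ->
    [set f u; f v] \in copy_edges (join T1 T2) f.
  by move=> uv; rewrite -f2; apply: imset_f.
pose F u v := adj (join T1 T2) u v && ([set f u; f v] \notin E').
have symF : symmetric F by move=> u v; rewrite /F adjC setUC.
have irrF : irreflexive F.
  by move=> u; apply/negP => /andP[/adj_neq]; rewrite eqxx.
have injh : injective (fun u => f u : nat) by move=> u v /val_inj/injf.
(* Both edges have the colour of the singleton of [f u], so in a rainbow copy they coincide. *)
have fwdF u v w : F u v -> F u w -> f u < f v -> f u < f w -> v = w.
  move=> /andP[uv Fuv] /andP[uw Fuw] luv luw; apply: injf.
  have : [set f u; f v] = [set f u; f w].
    apply: rb; [exact: in_copy | exact: in_copy |].
    apply/eqP; rewrite cE ?inK ?neq_ltn ?luv ?luw //.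
    by rewrite !c0lt.
  move/setP/(_ (f v)); rewrite !inE eqxx orbT => /esym/orP[/eqP E | /eqP //].
  by rewrite E ltnn in luv.
have sideF u v : u != v -> join_rel T1 T2 u v ->
    (f u \in A) = (f v \in A) -> F u v.
  move=> uv ruv E; rewrite /F edges_join_adj uv ruv inE negb_and.
  rewrite card_set2I ?E ?addbb ?orbT //.
  by apply: contra uv => /eqP/injf ->.
rewrite -V1s -V2t in s2 t2 KG.
have [P [Q [[Ps Qt] dPQ [sP sQ] PQ]]] :=
  join_spanning_split cT1 cT2 s2 t2 symF injh irrF fwdF sideF.
case/negP: KG; move: s2 t2 Ps Qt.
case: #|V1| => // s' _; case: #|V2| => // t' _ Ps Qt.
apply: (@has_copy_Kst_minus _ _ (f @: P) (f @: Q)).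
- by rewrite card_imset.
- by rewrite card_imset.
- rewrite disjoint_subset; apply/subsetP=> _ /imsetP[p pP ->].
  apply/negP => /imsetP[q qQ] /injf E.
  by have /disjointFr/(_ pP) := dPQ; rewrite E qQ.
move=> _ _ _ _ /imsetP[p pP ->] /imsetP[p' p'P ->]
  /imsetP[q qQ ->] /imsetP[q' q'Q ->].
(* Pairs missing in [G] are not kept, so they lie in [F], which has at most one edge between [P] and
   [Q]. *)
have crossF x y : x \in P -> y \in Q -> ~~ adj G (f x) (f y) -> F x y.
  move=> xP yQ nG; have nE' := contra (@E'G [set f x; f y]) nG.
  rewrite /F edges_join_adj PQ // nE' !andbT.
  by apply: contraTneq xP => ->; rewrite (disjointFl dPQ).
move=> /(crossF _ _ pP qQ) pq /(crossF _ _ p'P q'Q) p'q'.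
by have [-> ->] := unique_crossing_edge symF injh irrF fwdF sP sQ dPQ
  pP p'P qQ q'Q pq p'q'.
Qed.

(** * Passage to real exponents *)

Import Order.TTheory GRing.Theory Num.Theory.
Local Open Scope ring_scope.

Theorem theorem1p8 (R : realType) (s t : nat) (hs : (3 <= s)%N)
    (hst : (s <= t)%N) :
  exists c : R,
    forall (V1 V2 : finType) (T1 : sgraph V1) (T2 : sgraph V2),
      is_tree T1 -> is_tree T2 -> #|V1| = s -> #|V2| = t ->
      forall n : nat, (s + t <= n)%N ->
        (ex n (Kst_minus s t))%:R / 2 <= (ar_star n (join T1 T2))%:R :> R /\
        (ar_star n (join T1 T2))%:R <= c * n%:R `^ (2 - s%:R^-1) :> R.
Proof.
have s0 : (0 < s)%N by exact: ltn_trans hs.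
(* [K.+1] spares an [s]-th root, as K <= (K + 1)^s. *)
have [K KP] := ar_star_expn_le t s0; exists K.+1%:R.
move=> V1 V2 T1 T2 tT1 tT2 V1s V2t n nst; split.
  rewrite ler_pdivrMr // -natrM ler_nat mulnC.
  apply: ex_Kst_minus_le_ar_star => //; [by case: tT1 | by case: tT2 | | ].
    exact: leq_trans hst.
  by apply: leq_trans nst; lia.
(* Both sides are raised to the power [s], which turns the exponent into s + (s - 1). *)
rewrite -(@ler_pXn2r _ s) ?nnegrE ?mulr_ge0 ?powR_ge0 ?ler0n //.
rewrite exprMn -(powR_mulrn s (powR_ge0 _ _)) -powRrM.
have -> : (2 - s%:R^-1) * s%:R = (s + s.-1)%:R :> R.
  rewrite mulrBl mulVf ?pnatr_eq0 -?lt0n //.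
  by apply/eqP; rewrite subr_eq natr1 -natrM eqr_nat; apply/eqP; lia.
rewrite powR_mulrn ?ler0n // -!natrX -natrM ler_nat mulnC expnD.
apply: leq_trans (KP _ _ _ _ tT1 tT2 V1s V2t n) _.
rewrite leq_mul2l; apply/orP; right.
by apply: leq_trans (leqnSn K) _; case: (s) s0 => // s' _; apply: (@leq_pexp2l K.+1 1).
Qed.
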